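(* Let $\mathcal{G}$ be a sufficiently generic filter on $\mathbb{P}$. Then $(\vec{R}^{\mathcal{G}} \oplus f^{\mathcal{G}})'$ is not of PA degree relative to $\mathbf{0}'$.
   Context: $\mathbb{P}$ (Cohen forcing with locks) is the following notion of forcing. A condition is a tuple $p = (\sigma_0,\ldots,\sigma_{k-1},f)$ where $\sigma_0,\ldots,\sigma_{k-1}$ are finite binary strings and $f$ is a function from $\{0,\ldots,k-1\}$ to $\{0,1,u\}$. A condition $q = (\tau_0,\ldots,\tau_{\ell-1},g)$ extends $p$, written $q \leq p$, if: $\ell\geq k$; $g$ extends $f$ as a function; $\sigma_i \preceq \tau_i$ (initial segment) for all $i<k$; and for all $i<k$ with $f(i)\in\{0,1\}$ and every $x$ with $|\sigma_i|\leq x<|\tau_i|$, we have $\tau_i(x)=f(i)$. For a generic filter $\mathcal{G}$ on $\mathbb{P}$, let $R^{\mathcal{G}}_i = \bigcup\{\sigma_i : (\sigma_0,\ldots,\sigma_{k-1},f)\in\mathcal{G},\ i<k\}$ (an element of $2^\omega$, identified with a subset of $\omega$), $\vec{R}^{\mathcal{G}} = \langle R^{\mathcal{G}}_0,R^{\mathcal{G}}_1,\ldots\rangle$ (coded as a single set), and $f^{\mathcal{G}} = \bigcup\{f : (\sigma_0,\ldots,\sigma_{k-1},f)\in\mathcal{G}\} : \omega\to\{0,1,u\}$. ''Sufficiently generic'' means that $\mathcal{G}$ meets all sets in some suitable fixed countable collection of dense subsets of $\mathbb{P}$. A set $Y$ is of PA degree relative to $\mathbf{0}'$ if $Y$ computes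 a $\{0,1\}$-valued function that is diagonally non-computable relative to $\emptyset'$ (equivalently, $Y$ computes a path through every infinite $\emptyset'$-computable subtree of $2^{<\omega}$). The prime denotes the Turing jump. *)

(* Defs.v *)
From mathcomp Require Import all_boot.
From mathcomp Require Import classical_sets functions cardinality.
From Stdlib Require Cantor.

Set Implicit Arguments.
Unset Strict Implicit.
Unset Printing Implicit Defensive.

Local Open Scope classical_set_scope.

(** * Relative computability *)

Definition pairn (x y : nat) : nat := Cantor.to_nat (x, y).
Definition pi1 (z : nat) : nat := (Cantor.of_nat z).1.
Definition pi2 (z : nat) : nat := (Cantor.of_nat z).2.

(* Programs for the unary partial recursive functions relative to an oracle;
   several arguments are passed as one through the Cantor pairing. *)
Inductive code : Type :=
| Zero | Succ | Fst | Snd | Query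
| Pair of code & code
| Comp of code & code
| Prec of code & code
| Mu of code.

(* [eval A c x y]: the program [c] with oracle [A] halts on [x] with output
   [y]. [Prec c d] is the function h with h(a,0) = c(a) and
   h(a,n+1) = d(a,(n,h(a,n))). [Mu c] sends x to the least y with c(x,y) = 0,
   where c(x,m) has to be defined for all m < y. *)
Fixpoint eval (A : set nat) (c : code) (x y : nat) {struct c} : Prop :=
  match c with
  | Zero => y = 0
  | Succ => y = x.+1
  | Fst => y = pi1 x
  | Snd => y = pi2 x
  | Query => (A x /\ y = 1) \/ (~ A x /\ y = 0)
  | Pair c d => exists u v, [/\ eval A c x u, eval A d x v & y = pairn u v]
  | Comp c d => exists2 z, eval A d x z & eval A c z y
  | Prec c d =>
      let a := pi1 x in
      (fix rec (n : nat) (w : nat) : Prop :=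
         match n with
         | 0 => eval A c a w
         | n.+1 => exists2 z, rec n z & eval A d (pairn a (pairn n z)) w
         end) (pi2 x) y
  | Mu c => eval A c (pairn x y) 0 /\
            (forall m, m < y -> exists k, eval A c (pairn x m) k.+1)
  end.

Fixpoint godel (c : code) : nat :=
  match c with
  | Zero => pairn 0 0
  | Succ => pairn 1 0
  | Fst => pairn 2 0
  | Snd => pairn 3 0
  | Query => pairn 4 0
  | Pair c d => pairn 5 (pairn (godel c) (godel d))
  | Comp c d => pairn 6 (pairn (godel c) (godel d))
  | Prec c d => pairn 7 (pairn (godel c) (godel d))
  | Mu c => pairn 8 (godel c)
  end.

(* The graph of the e-th partial A-recursive function. An e that is not the
   number of a program is an index of the empty function. *)
Definition phi (A : set nat) (e x y : nat) : Prop :=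
  exists2 c : code, godel c = e & eval A c x y.

Definition jump (A : set nat) : set nat := [set e | exists y, phi A e e y].

Definition computes (Y : set nat) (g : nat -> nat) : Prop :=
  exists e, forall x, phi Y e x (g x).

Definition DNC (X : set nat) (g : nat -> nat) : Prop :=
  forall e, ~ phi X e e (g e).

Definition PA_relative_to (X Y : set nat) : Prop :=
  exists g : nat -> bool, computes Y g /\ DNC X g.

Definition join (A B : set nat) : set nat :=
  [set n | if odd n then B n./2 else A n./2].

(** * Cohen forcing with locks *)

(* [Some b] is the lock value b in {0,1}; [None] is the value u. *)
Definition lock := option bool.

(* The tuple (s_0, ..., s_(k-1), f) is the sequence of the k pairs
   (s_i, f i); thus k is the size of the sequence. *)
Definition cond := seq (seq bool * lock).

(* Only meaningful for [i < size p]. *)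
Definition stem (p : cond) (i : nat) : seq bool := (nth ([::], None) p i).1.
Definition lck (p : cond) (i : nat) : lock := (nth ([::], None) p i).2.

Definition extends (q p : cond) : Prop :=
  [/\ size p <= size q,
      forall i, i < size p -> lck q i = lck p i,
      forall i, i < size p -> prefix (stem p i) (stem q i) &
      forall i (b : bool), i < size p -> lck p i = Some b ->
        forall x, size (stem p i) <= x < size (stem q i) ->
          nth false (stem q i) x = b].

Definition forcing_filter (G : set cond) : Prop :=
  [/\ G !=set0,
      forall p q, G q -> extends q p -> G p &
      forall p q, G p -> G q -> exists r, [/\ G r, extends r p & extends r q]].

Definition forcing_dense (S : set cond) : Prop :=
  forall p, exists2 q, S q & extends q p.

(* The union R_i of the stems, as the subset of omega whose elements are the
   arguments where this union takes the value 1. *)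
Definition RG (G : set cond) (i : nat) : set nat :=
  [set x | exists p, [/\ G p, i < size p, x < size (stem p i) &
                         nth false (stem p i) x = true]].

Definition RvecG (G : set cond) : set nat := [set z | RG G (pi1 z) (pi2 z)].

(* The union of the functions f, as a graph. *)
Definition fG (G : set cond) (i : nat) (v : lock) : Prop :=
  exists p, [/\ G p, i < size p & lck p i = v].

Definition lock_num (v : lock) : nat := if v is Some b then b : nat else 2.

Definition fG_set (G : set cond) : set nat :=
  [set z | exists2 v, fG G (pi1 z) v & pi2 z = lock_num v].

(* Main.v *)
(* A generic filter does not even allow its jump to compute a diagonally
   non-computable function relative to 0', {0,1}-valued or not. The oracle 0'
   decides whether some extension of a condition q forces n into the jump of the
   generic: this is a Sigma_1 question, because finitely much of the generic is
   read off from q. Hence 0' can search below p for a condition forcing a given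
   functional of the jump to converge. If no condition below p forces divergence
   somewhere, this search is a total function h computable from 0'. With a an
   index of h, the condition found on the input a forces the functional to take
   at a the value h(a) of the a-th program relative to 0' on a.

   Running a program on partial information about its oracle, with a bound on its
   unbounded searches, is a total process, and the program can be compiled into one
   that performs it. The compilation is computable on numbers of programs, so no
   universal machine is needed to phrase the questions to 0'. *)
Require Import Defs.
From mathcomp Require Import all_boot.
From mathcomp Require Import boolp classical_sets functions cardinality.
From Stdlib Require Cantor.

Set Implicit Arguments.
Unset Strict Implicit.
Unset Printing Implicit Defensive.

Local Open Scope classical_set_scope.

Local Arguments pairn : simpl never.
Local Arguments pi1 : simpl never.
Local Arguments pi2 : simpl never.

(** * Pairing, and determinism of programs *)

Lemma pi1_pairn x y : pi1 (pairn x y) = x.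
Proof. by rewrite /pi1 /pairn Cantor.cancel_of_to. Qed.

Lemma pi2_pairn x y : pi2 (pairn x y) = y.
Proof. by rewrite /pi2 /pairn Cantor.cancel_of_to. Qed.

Lemma pairn_pi z : pairn (pi1 z) (pi2 z) = z.
Proof. by rewrite /pi1 /pi2 /pairn -surjective_pairing Cantor.cancel_to_of. Qed.

Definition piE := (pi1_pairn, pi2_pairn).

Lemma leq_add_pairn x y : x + y <= pairn x y.
Proof.
rewrite addnC; apply/leP; rewrite -plusE; exact: Cantor.to_nat_non_decreasing.
Qed.

Lemma eval_fun A c x y z : eval A c x y -> eval A c x z -> y = z.
Proof.
elim: c x y z => [||||| c IHc d IHd | c IHc d IHd | c IHc d IHd | c IHc] x y z /=.
- by move=> -> ->.
- by move=> -> ->.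
- by move=> -> ->.
- by move=> -> ->.
- by move=> [[h ->]|[h ->]] [[h' ->]|[h' ->]].
- move=> [u [v [cu dv ->]]] [u' [v' [cu' dv' ->]]].
  by rewrite (IHc _ _ _ cu cu') (IHd _ _ _ dv dv').
- move=> [u du cu] [v dv cv]; rewrite -(IHd _ _ _ du dv) in cv; exact: IHc cu cv.
- elim: (pi2 x) y z => [|n IHn] y z; first exact: IHc.
  move=> [u nu du] [v nv dv]; rewrite -(IHn _ _ nu nv) in dv; exact: IHd du dv.
- move=> [cy hy] [cz hz]; case: (ltngtP y z) => // lt.
    by have [k ck] := hz _ lt; have := IHc _ _ _ cy ck.
  by have [k ck] := hy _ lt; have := IHc _ _ _ cz ck.
Qed.

Lemma godel_inj : injective godel.
Proof.
have pinj a b a' b' : pairn a b = pairn a' b' -> a = a' /\ b = b'.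
  by move=> e; rewrite -(pi1_pairn a b) -{2}(pi2_pairn a b) e !piE.
by elim=> [||||| c IHc d IHd | c IHc d IHd | c IHc d IHd | c IHc]
  [||||| c' d' | c' d' | c' d' | c'] /= /pinj[] //= _;
  first [move=> /pinj[/IHc -> /IHd ->] | move=> /IHc ->].
Qed.

(** * Total computable functions *)

(** One program serves all oracles in [O]: the class [setT] gives outright computability, a
    singleton computability from one set. Being a sigma type in [Type], it lets the program be
    extracted and its number used. *)
Definition computable (O : set (set nat)) (f : nat -> nat) : Type :=
  {c : code | forall A, O A -> forall x, eval A c x (f x)}.

Section Closure.
Variable O : set (set nat).
Implicit Types (f g h : nat -> nat) (b : nat -> bool).

Lemma computable_id : computable O id.
Proof. by exists (Pair Fst Snd) => A _ x; exists (pi1 x), (pi2 x); rewrite pairn_pi. Defined.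

Lemma computable_comp f g :
  computable O f -> computable O g -> computable O (fun x => f (g x)).
Proof. by move=> [c cP] [d dP]; exists (Comp c d) => A OA x; exists (g x); auto. Qed.

Lemma computable_succ f : computable O f -> computable O (fun x => (f x).+1).
Proof. by move=> cf; apply: (computable_comp (f := succn)) cf; exists Succ. Qed.

Lemma computable_pi1 f : computable O f -> computable O (fun x => pi1 (f x)).
Proof. by move=> cf; apply: (computable_comp (f := pi1)) cf; exists Fst. Qed.

Lemma computable_pi2 f : computable O f -> computable O (fun x => pi2 (f x)).
Proof. by move=> cf; apply: (computable_comp (f := pi2)) cf; exists Snd. Qed.

Lemma computable_const k : computable O (fun=> k).
Proof. by elim: k => [|k]; [exists Zero | apply: computable_succ]. Qed.

Lemma computable_pairn f g :
  computable O f -> computable O g -> computable O (fun x => pairn (f x) (g x)).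
Proof.
by move=> [c cP] [d dP]; exists (Pair c d) => A OA x; exists (f x), (g x); split; auto.
Qed.

(** [Prec] keeps the parameter [x] in the first component, so the step sees [(x, (n, z))]. Case
    distinctions, comparisons and bounded quantifiers below all reduce to this rule. *)
Lemma computable_iteri f (g : nat -> nat -> nat -> nat) h :
    computable O f ->
    computable O (fun y => g (pi1 y) (pi1 (pi2 y)) (pi2 (pi2 y))) ->
    computable O h ->
  computable O (fun x => iteri (h x) (g x) (f x)).
Proof.
move=> [cf cfP] [cg cgP] ch.
have [d dP] := computable_pairn computable_id ch.
exists (Comp (Prec cf cg) d) => A OA x; exists (pairn x (h x)); first exact: dP.
rewrite /= !piE; elim: (h x) => [|n IHn] /=; first exact: cfP.
exists (iteri n (g x) (f x)) => //.
by have := cgP A OA (pairn x (pairn n (iteri n (g x) (f x)))); rewrite !piE.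
Qed.

Lemma computable_eq f g : f =1 g -> computable O f -> computable O g.
Proof. by move=> fg [c cP]; exists c => A OA x; rewrite -fg; auto. Qed.

End Closure.

Create HintDb comp.
#[local] Hint Resolve computable_id computable_succ computable_pi1 computable_pi2
  computable_const computable_pairn : comp.
Ltac comp := by auto 100 with comp nocore.

Section Arithmetic.
Variable O : set (set nat).
Implicit Types (f g h : nat -> nat) (b : nat -> bool).

Lemma computable_pred f : computable O f -> computable O (fun x => (f x).-1).
Proof.
move=> cf; apply: (@computable_eq _ (fun x => iteri (f x) (fun n _ => n) 0)).
  by move=> x; case: (f x).
by apply: computable_iteri => //; comp.
Qed.

Lemma computable_sub f g :
  computable O f -> computable O g -> computable O (fun x => f x - g x).
Proof.
move=> cf cg; apply: (@computable_eq _ (fun x => iteri (g x) (fun _ z => z.-1) (f x))).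
  by move=> x; elim: (g x) => [|n IHn] /=; rewrite ?subn0 // IHn subnS.
apply: computable_iteri => //; apply: computable_pred; comp.
Qed.

Lemma computable_if b f g :
    computable O b -> computable O f -> computable O g ->
  computable O (fun x => if b x then f x else g x).
Proof.
move=> cb cf cg.
apply: (@computable_eq _ (fun x => iteri (b x) (fun _ _ => f x) (g x))) => [x|].
  by case: (b x).
apply: computable_iteri => //.
by apply: (computable_comp (f := f)) => //; comp.
Qed.

Lemma computable_neg b : computable O b -> computable O (fun x => ~~ b x).
Proof.
move=> cb; apply: (@computable_eq _ (fun x => if b x then 0 else 1)) => [x|].
  by case: (b x).
by apply: computable_if => //; comp.
Qed.

Lemma computable_and b (b' : nat -> bool) :
  computable O b -> computable O b' -> computable O (fun x => b x && b' x).
Proof.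
move=> cb cb'; apply: (@computable_eq _ (fun x => if b x then b' x : nat else 0)) => [x|].
  by case: (b x).
by apply: computable_if => //; comp.
Qed.

Lemma computable_or b (b' : nat -> bool) :
  computable O b -> computable O b' -> computable O (fun x => b x || b' x).
Proof.
move=> cb cb'; apply: (@computable_eq _ (fun x => if b x then 1 else b' x)) => [x|].
  by case: (b x).
by apply: computable_if => //; comp.
Qed.

Lemma computable_leq f g :
  computable O f -> computable O g -> computable O (fun x => f x <= g x).
Proof.
move=> cf cg; have cs := computable_sub cf cg.
apply: (@computable_eq _ (fun x => iteri (f x - g x) (fun _ _ => 0) 1)) => [x|].
  by rewrite /leq; case: (_ - _).
by apply: computable_iteri => //; comp.
Qed.

Lemma computable_eqn f g :
  computable O f -> computable O g -> computable O (fun x => f x == g x).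
Proof.
move=> cf cg.
apply: (@computable_eq _ (fun x => (f x <= g x) && (g x <= f x))) => [x|].
  by rewrite eqn_leq.
by apply: computable_and; apply: computable_leq.
Qed.

Lemma computable_all (p : nat -> nat -> bool) f :
    computable O (fun y => p (pi1 y) (pi2 y)) -> computable O f ->
  computable O (fun x => all (p x) (iota 0 (f x))).
Proof.
move=> cp cf.
apply: (@computable_eq _ (fun x => iteri (f x) (fun n z => (z != 0) && p x n) 1)) => [x|].
  elim: (f x) => [//|n IHn]; rewrite -addn1 iotaD all_cat add0n addn1 /= IHn andbT.
  by case: all.
apply: computable_iteri => //; first comp.
apply: computable_and; first by apply: computable_neg; apply: computable_eqn; comp.
pose q z := pairn (pi1 z) (pi1 (pi2 z)).
apply: (@computable_eq _ (fun z => p (pi1 (q z)) (pi2 (q z)))) => [z|].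
  by rewrite !piE.
by apply: (computable_comp (f := fun y => p (pi1 y) (pi2 y))) => //; rewrite /q; comp.
Qed.

End Arithmetic.
#[local] Hint Resolve computable_pred computable_sub computable_if computable_neg
  computable_and computable_or computable_leq computable_eqn : comp.

(* Entry [i] of the list coded by [t]: every [t] codes an infinite list. *)
Definition entry t i : nat := pi1 (iter i pi2 t).

Section Entry.
Variable O : set (set nat).
Implicit Types (f g : nat -> nat).

Lemma computable_entry f g :
  computable O f -> computable O g -> computable O (fun x => entry (f x) (g x)).
Proof.
move=> cf cg; apply: computable_pi1.
apply: (@computable_eq _ (fun x => iteri (g x) (fun _ z => pi2 z) (f x))) => [x|].
  by elim: (g x) => //= n ->.
by apply: computable_iteri => //; comp.
Qed.

Lemma computable_odd f : computable O f -> computable O (fun x => odd (f x)).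
Proof.
move=> cf; apply: (@computable_eq _ (fun x => iteri (f x) (fun _ z => (z == 0) : nat) 0)) => [x|].
  by elim: (f x) => //= n ->; case: odd.
by apply: computable_iteri => //; comp.
Qed.

Lemma computable_half f : computable O f -> computable O (fun x => (f x)./2).
Proof.
move=> cf; apply: (@computable_eq _ (fun x =>
  iteri (f x) (fun n z => if odd n then z.+1 else z) 0)) => [x|].
  by elim: (f x) => //= n ->; rewrite uphalf_half; case: odd.
apply: computable_iteri => //; first comp.
by apply: computable_if; [apply: computable_odd| |]; comp.
Qed.

End Entry.
#[local] Hint Resolve computable_entry computable_odd computable_half : comp.

(** * Codes of lists and course-of-values recursion *)

Lemma entryP (f : nat -> nat) k : exists t, forall i, i < k -> entry t i = f i.
Proof.
elim: k f => [|k IHk] f; first by exists 0.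
have [t tP] := IHk (f \o succn); exists (pairn (f 0) t) => -[|i] ik.
  by rewrite /entry /= piE.
by rewrite /entry iterSr piE; apply: tP.
Qed.

(** The latest value comes first, so that one pairing appends a value; [F m] then sits at position
    [n - m.+1]. *)
Definition history (F : nat -> nat) n : nat := iteri n (fun m h => pairn (F m) h) 0.

Lemma entry_history F n m : m < n -> entry (history F n) (n - m.+1) = F m.
Proof.
elim: n => [//|n IHn]; rewrite ltnS leq_eqVlt => /orP[/eqP ->|mn].
  by rewrite subnn /entry /= piE.
rewrite subSS -(subnSK mn) /entry iterSr /= piE; exact: IHn.
Qed.

(** The history is itself a plain iteration once each [F m] is replaced by [S] applied to [m] and
    the history so far. *)
Lemma computable_course_of_values O F S :
    computable O S -> (forall n, F n = S (pairn n (history F n))) ->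
  computable O F.
Proof.
move=> cS FS.
apply: (@computable_eq _ (fun n => S (pairn n (history F n)))) => [n|]; first by rewrite -FS.
apply: (computable_comp (f := S)) => //; apply: computable_pairn; first comp.
apply: (@computable_eq _ (fun n => iteri n (fun m h => pairn (S (pairn m h)) h) 0)) => [n|].
  by rewrite /history; elim: n => [//|n /= ->]; rewrite -FS.
apply: (computable_iteri (h := id)); [comp| |comp].
by apply: computable_pairn; [apply: (computable_comp (f := S))|]; comp.
Qed.

(** * Bounded evaluation from partial information on the oracle *)

(* Partial values are coded by numbers: [0] is undefined and [y.+1] is the
   value [y]. *)
Definition obind u v : nat := if u == 0 then 0 else v.
Definition opair u v : nat := obind u (obind v (pairn u.-1 v.-1).+1).

(* States of a search for a zero: [0] for failure, [1] while searching and
   [m.+2] once the zero [m] is found. The value of the function at [m] is [r]. *)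
Definition search_step m st r : nat :=
  if st == 1 then (if r == 0 then 0 else if r == 1 then m.+2 else 1) else st.

Definition search (r : nat -> nat) s : nat :=
  iteri s (fun m st => search_step m st (r m)) 1.

(* Only the unbounded searches are cut off by [s]; this makes [bounded_eval]
   total. *)
Fixpoint bounded_eval (l : nat -> nat) s (c : code) (x : nat) {struct c} : nat :=
  match c with
  | Zero => 1
  | Succ => x.+2
  | Fst => (pi1 x).+1
  | Snd => (pi2 x).+1
  | Query => l x
  | Pair c d => opair (bounded_eval l s c x) (bounded_eval l s d x)
  | Comp c d => obind (bounded_eval l s d x) (bounded_eval l s c (bounded_eval l s d x).-1)
  | Prec c d =>
      iteri (pi2 x)
        (fun n z => obind z (bounded_eval l s d (pairn (pi1 x) (pairn n z.-1))))
        (bounded_eval l s c (pi1 x))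
  | Mu c => (search (fun m => bounded_eval l s c (pairn x m)) s).-1
  end.

Lemma obind_succ u v y : obind u v = y.+1 -> exists2 z, u = z.+1 & v = y.+1.
Proof. by case: u => // u; exists u. Qed.

Lemma opair_succ u v y :
  opair u v = y.+1 -> exists a b, [/\ u = a.+1, v = b.+1 & y = pairn a b].
Proof. by case: u v => [|a] [|b] // [<-]; exists a, b. Qed.

(** In the coding of partial values, [r m = 1] is a zero at [m] and [1 < r m] a nonzero value. Both
    claims go through one induction on [s], since a zero can only be found from the state that is
    still searching. *)
Lemma searchP r s :
  (search r s = 1 <-> forall m, m < s -> 1 < r m) /\
  (forall y, search r s = y.+2 <-> [/\ y < s, r y = 1 & forall m, m < y -> 1 < r m]).
Proof.
elim: s => [|s [IH1 IH2]]; first by split=> //; split=> // -[].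
have -> : search r s.+1 = search_step s (search r s) (r s) by [].
rewrite /search_step; case: eqP => [e|ne].
  have rs := IH1.1 e; case: eqP => [r0|r0].
    split=> [|y]; split=> //; first by move=> /(_ s (leqnn _)); rewrite r0.
    case=> ys ry _; move: ys; rewrite ltnS leq_eqVlt => /orP[/eqP ys|/rs].
      by rewrite ys r0 in ry.
    by rewrite ry.
  case: eqP => [r1|r1].
    split=> [|y]; split=> //; first by move=> /(_ s (leqnn _)); rewrite r1.
      by case=> <-; split.
    case=> ys ry _; move: ys; rewrite ltnS leq_eqVlt => /orP[/eqP -> //|/rs].
    by rewrite ry.
  have rs1 : 1 < r s by case: (r s) r0 r1 => [|[]].
  split=> [|y]; split=> //.
    by move=> _ m; rewrite ltnS leq_eqVlt => /orP[/eqP ->|/rs].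
  case=> ys ry _; move: ys; rewrite ltnS leq_eqVlt => /orP[/eqP ys|/rs].
    by rewrite -ys ry in rs1.
  by rewrite ry.
split=> [|y]; split=> //.
- by move=> h; case: ne; apply/IH1 => m ms; apply: h; apply: leqW.
- by move=> /IH2[ys ry h]; split=> //; apply: leqW.
- case=> ys ry h; apply/IH2; split=> //; move: ys; rewrite ltnS leq_eqVlt => /orP[/eqP ys|//].
  by case: ne; apply/IH1; rewrite -ys.
Qed.

(** The predecessor sends both failure and an unfinished search to [0], the undefined value. *)
Lemma search_succ r s y :
  (search r s).-1 = y.+1 <-> [/\ y < s, r y = 1 & forall m, m < y -> 1 < r m].
Proof. by rewrite -(searchP r s).2; case: search => [|[]] //= n; split=> [->|[->]]. Qed.

(** A convergent run rests only on answers that were given and on searches that ended in time; more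
    information or a larger bound changes neither. *)
Lemma bounded_eval_mono l l' s s' c x y :
    (forall z b, l z = b.+1 -> l' z = b.+1) -> s <= s' ->
  bounded_eval l s c x = y.+1 -> bounded_eval l' s' c x = y.+1.
Proof.
move=> ll ss; elim: c x y => [||||| c IHc d IHd | c IHc d IHd | c IHc d IHd | c IHc] x y //=.
- exact: ll.
- move=> /opair_succ[a [b [ca db ->]]].
  by rewrite (IHc _ _ ca) (IHd _ _ db).
- move=> /obind_succ[z dz]; rewrite (IHd _ _ dz) dz /=; exact: IHc.
- elim: (pi2 x) y => [|n IHn] y /=; first exact: IHc.
  by move=> /obind_succ[z nz]; rewrite (IHn _ nz) nz; apply: IHd.
- move=> /search_succ[ys cy hy]; apply/search_succ; split.
  + exact: leq_trans ss.
  + exact: IHc cy.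
  + move=> m my; have := hy m my.
    by case e: (bounded_eval l s c _) => [|[|k]] // _; rewrite (IHc _ _ e).
Qed.

(** The hypotheses allow [l] to be silent but never wrong: [1] means no, [2] means yes, and no
    larger answer occurs. *)
Lemma bounded_eval_sound A l s c x y :
    (forall z, l z = 1 -> ~ A z) -> (forall z b, l z = b.+2 -> A z /\ b = 0) ->
  bounded_eval l s c x = y.+1 -> eval A c x y.
Proof.
move=> l1 l2; elim: c x y => [||||| c IHc d IHd | c IHc d IHd | c IHc d IHd | c IHc] x y /=.
- by case.
- by case.
- by case.
- by case.
- by case: y => [/l1|y /l2[Ax ->]]; [right|left].
- by move=> /opair_succ[a [b [/IHc ca /IHd db ->]]]; exists a, b.
- by move=> /obind_succ[z dz]; rewrite dz => /IHc cy; exists z => //; apply: IHd.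
- elim: (pi2 x) y => [|n IHn] y /=; first exact: IHc.
  move=> /obind_succ[z nz]; rewrite nz => /IHd dy.
  by exists z => //; apply: IHn.
- move=> /search_succ[ys /IHc cy hy]; split=> // m /hy.
  by case e: (bounded_eval l s c _) => [|[|k]] // _; exists k; apply: IHc.
Qed.

Definition initial_answers (A : set nat) s z : nat :=
  if z < s then (`[< A z >] : nat).+1 else 0.

Lemma initial_answers_mono A s s' z b :
  s <= s' -> initial_answers A s z = b.+1 -> initial_answers A s' z = b.+1.
Proof.
by rewrite /initial_answers => ss; case: ltnP => // zs; rewrite (leq_trans zs ss).
Qed.

(** The use principle: a halting computation asks finitely many questions and makes finite searches.
    By monotonicity the bounds of its parts can be replaced by their maximum, so one [s] limits both
    questions and searches. *)
Lemma bounded_eval_complete A c x y :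
  eval A c x y -> exists s, bounded_eval (initial_answers A s) s c x = y.+1.
Proof.
pose B s := bounded_eval (initial_answers A s) s.
have mono s s' c' x' y' : s <= s' -> B s c' x' = y'.+1 -> B s' c' x' = y'.+1.
  by move=> ss; apply: bounded_eval_mono => // z b; apply: initial_answers_mono.
elim: c x y => [||||| c IHc d IHd | c IHc d IHd | c IHc d IHd | c IHc] x y /=.
- by move=> ->; exists 0.
- by move=> ->; exists 0.
- by move=> ->; exists 0.
- by move=> ->; exists 0.
- exists x.+1; rewrite /initial_answers leqnn.
  by case: H => -[Ax ->]; congr S; [rewrite asboolT|rewrite asboolF].
- move=> [u [v [/IHc[s cs] /IHd[t dt] ->]]]; exists (maxn s t).
  by rewrite -/(B _ c x) -/(B _ d x) (mono _ _ _ _ _ (leq_maxl s t) cs)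
     (mono _ _ _ _ _ (leq_maxr s t) dt).
- move=> [z /IHd[t dt] /IHc[s cs]]; exists (maxn s t).
  rewrite -/(B _ d x) (mono _ _ _ _ _ (leq_maxr s t) dt) /obind /=.
  by apply: mono cs; apply: leq_maxl.
- elim: (pi2 x) y => [|n IHn] y /=; first exact: IHc.
  move=> [z /IHn[s ns] /IHd[t dt]]; exists (maxn s t).
  (* The recursion up to [n] converged with the bound [s]; an induction over its stages lifts it to
     the common bound. *)
  set it := iteri _ _ _; have -> : it = z.+1.
    rewrite {}/it; move: ns; clear -mono.
    elim: n z => [|n IHn] z /=; first by apply: mono; apply: leq_maxl.
    move=> /obind_succ[v nv]; rewrite (IHn _ nv) nv /obind /=.
    by apply: mono; apply: leq_maxl.
  by rewrite /obind /=; apply: mono dt; apply: leq_maxr.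
- move=> [/IHc[s cs] hy].
  (* Only finitely many values precede the zero, so a single bound works for all of them. *)
  have [t tP] : exists t, forall m, m < y -> 1 < B t c (pairn x m).
    elim: (y) hy => [|n IHn] hn; first by exists 0.
    have [t tP] : exists t, forall m, m < n -> 1 < B t c (pairn x m).
      by apply: IHn => m mn; apply: hn; apply: leqW.
    have [k /IHc[t' t'P]] := hn n (leqnn _).
    exists (maxn t t') => m; rewrite ltnS leq_eqVlt => /orP[/eqP ->|mn].
      by rewrite (mono _ _ _ _ _ (leq_maxr t t') t'P).
    have := tP m mn; case e: (B t c _) => [|[|j]] // _.
    by rewrite (mono _ _ _ _ _ (leq_maxl t t') e).
  exists (maxn y.+1 (maxn s t)); apply/search_succ; split; first exact: leq_maxl.
    by apply: mono cs; rewrite !leq_max leqnn !orbT.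
  move=> m /tP; case e: (B t c _) => [|[|j]] // _.
  have tu : t <= maxn y.+1 (maxn s t) by rewrite !leq_max leqnn !orbT.
  by have := mono _ _ _ _ _ tu e; rewrite /B => ->.
Qed.

Section Gadgets.
Variable O : set (set nat).

Lemma computable_obind f g :
  computable O f -> computable O g -> computable O (fun x => obind (f x) (g x)).
Proof. rewrite /obind; comp. Qed.

Lemma computable_opair f g :
  computable O f -> computable O g -> computable O (fun x => opair (f x) (g x)).
Proof. by move=> cf cg; do 2![apply: computable_obind => //]; comp. Qed.

Lemma computable_search_step f g h :
    computable O f -> computable O g -> computable O h ->
  computable O (fun x => search_step (f x) (g x) (h x)).
Proof. rewrite /search_step; comp. Qed.

End Gadgets.
#[local] Hint Resolve computable_obind computable_opair computable_search_step : comp.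

(** * Compiling a program into its bounded evaluation *)

Definition prog f (cf : computable setT f) : code := sval cf.

Lemma prog_eval A f (cf : computable setT f) x : eval A (prog cf) x (f x).
Proof. by case: cf => c; apply. Qed.

Definition prog_one : computable setT (fun=> 1).
Proof. comp. Qed.
Definition prog_pred : computable setT predn.
Proof. comp. Qed.
Definition prog_obind : computable setT (fun y => obind (pi1 y) (pi2 y)).
Proof. comp. Qed.
Definition prog_opair : computable setT (fun y => opair (pi1 y) (pi2 y)).
Proof. comp. Qed.
Definition prog_succ : computable setT (fun y => (pi2 y).+2).
Proof. comp. Qed.
Definition prog_fst : computable setT (fun y => (pi1 (pi2 y)).+1).
Proof. comp. Qed.
Definition prog_snd : computable setT (fun y => (pi2 (pi2 y)).+1).
Proof. comp. Qed.
Definition prog_query : computable setT (fun y => pairn (pi1 (pi1 y)) (pi2 y)).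
Proof. comp. Qed.
(* ((w, a), (n, z)) goes to z, respectively to (w, (a, (n, z - 1))) *)
Definition prog_prec_value : computable setT (fun y => pi2 (pi2 y)).
Proof. comp. Qed.
Definition prog_prec_step : computable setT (fun y =>
  pairn (pi1 (pi1 y)) (pairn (pi2 (pi1 y)) (pairn (pi1 (pi2 y)) (pi2 (pi2 y)).-1))).
Proof. comp. Qed.
(* (w, (a, n)) goes to ((w, a), n) *)
Definition prog_prec_init : computable setT (fun y =>
  pairn (pairn (pi1 y) (pi1 (pi2 y))) (pi2 (pi2 y))).
Proof. comp. Qed.
Definition prog_search_step : computable setT (fun y =>
  search_step (pi1 (pi1 y)) (pi2 (pi1 y)) (pi2 y)).
Proof. comp. Qed.
(* ((w, x), (m, st)) goes to (w, (x, m)) *)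
Definition prog_search_arg : computable setT (fun y =>
  pairn (pi1 (pi1 y)) (pairn (pi2 (pi1 y)) (pi1 (pi2 y)))).
Proof. comp. Qed.
(* ((q, s), x) goes to (((q, s), x), s) *)
Definition prog_search_init : computable setT (fun y => pairn y (pi2 (pi1 y))).
Proof. comp. Qed.

Definition compile_pair a b := Comp (prog prog_opair) (Pair a b).
(** Compiled programs halt whenever [L] does. Hence [a] may run even at the meaningless argument [0]
    that an undefined inner value leaves behind, and [obind] discards the outcome. *)
Definition compile_comp a b :=
  Comp (prog prog_obind) (Pair b (Comp a (Pair Fst (Comp (prog prog_pred) b)))).
Definition compile_prec a b :=
  Comp (Prec a (Comp (prog prog_obind)
         (Pair (prog prog_prec_value) (Comp b (prog prog_prec_step)))))
    (prog prog_prec_init).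
Definition compile_mu a :=
  Comp (prog prog_pred) (Comp (Prec (prog prog_one)
      (Comp (prog prog_search_step) (Pair Snd (Comp a (prog prog_search_arg)))))
    (prog prog_search_init)).

(* The input of the compiled program is ((q, s), x), where the partial
   information on the oracle is the one with index [q] that [L] computes. *)
Fixpoint compile (L c : code) : code :=
  match c with
  | Zero => prog prog_one
  | Succ => prog prog_succ
  | Fst => prog prog_fst
  | Snd => prog prog_snd
  | Query => Comp L (prog prog_query)
  | Pair c d => compile_pair (compile L c) (compile L d)
  | Comp c d => compile_comp (compile L c) (compile L d)
  | Prec c d => compile_prec (compile L c) (compile L d)
  | Mu c => compile_mu (compile L c)
  end.

Lemma eval_comp A c d x y z : eval A d x z -> eval A c z y -> eval A (Comp c d) x y.
Proof. by exists z. Qed.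

Lemma eval_pair A c d x y z :
  eval A c x y -> eval A d x z -> eval A (Pair c d) x (pairn y z).
Proof. by exists y, z. Qed.

Lemma eval_prec A c d x (f : nat -> nat) :
    eval A c (pi1 x) (f 0) ->
    (forall n, eval A d (pairn (pi1 x) (pairn n (f n))) (f n.+1)) ->
  eval A (Prec c d) x (f (pi2 x)).
Proof. by move=> c0 dS /=; elim: (pi2 x) => [|n IHn] //=; exists (f n). Qed.

Lemma eval_prog A f (cf : computable setT f) x y : f x = y -> eval A (prog cf) x y.
Proof. by move=> <-; apply: prog_eval. Qed.

(** The oracle [A] serves [L] alone; [c] only sees the partial information [l]. Convergence of [c]
    is not assumed, because bounded evaluation is total. *)
Lemma eval_compile A L l c w x :
    (forall q z, eval A L (pairn q z) (l q z)) ->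
  eval A (compile L c) (pairn w x) (bounded_eval (l (pi1 w)) (pi2 w) c x).
Proof.
move=> LP; elim: c x => [||||| c IHc d IHd | c IHc d IHd | c IHc d IHd | c IHc] x.
- exact: prog_eval.
- by apply: eval_prog; rewrite !piE.
- by apply: eval_prog; rewrite !piE.
- by apply: eval_prog; rewrite !piE.
- by apply: eval_comp (LP _ _); apply: eval_prog; rewrite !piE.
- by apply: eval_comp (eval_pair (IHc x) (IHd x)) _; apply: eval_prog; rewrite !piE.
- set z := bounded_eval (l (pi1 w)) (pi2 w) d x.
  apply: (eval_comp (z := pairn z (bounded_eval (l (pi1 w)) (pi2 w) c z.-1))).
    apply: eval_pair => //; apply: eval_comp (IHc _); apply: eval_pair.
      by rewrite /= piE.
    exact: eval_comp (prog_eval _ _ _).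
  by apply: eval_prog; rewrite !piE.
- apply: (eval_comp (z := pairn (pairn w (pi1 x)) (pi2 x))).
    by apply: eval_prog; rewrite !piE.
  pose f n := iteri n (fun n z =>
     obind z (bounded_eval (l (pi1 w)) (pi2 w) d (pairn (pi1 x) (pairn n z.-1))))
     (bounded_eval (l (pi1 w)) (pi2 w) c (pi1 x)).
  (* [eval_prec] expects the value as a function of the second component of the input. *)
  rewrite [bounded_eval _ _ _ _](_ : _ = f (pi2 (pairn (pairn w (pi1 x)) (pi2 x))));
    last by rewrite piE.
  apply: eval_prec; first by rewrite piE; apply: IHc.
  move=> n; rewrite piE; apply: eval_comp.
    apply: eval_pair; first exact: prog_eval.
    apply: eval_comp; first exact: prog_eval.
    by rewrite !piE; apply: IHd.
  by apply: eval_prog; rewrite !piE.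
- pose r m := bounded_eval (l (pi1 w)) (pi2 w) c (pairn x m).
  apply: (eval_comp (z := search r (pi2 w))); last exact: prog_eval.
  apply: (eval_comp (z := pairn (pairn w x) (pi2 w))).
    by apply: eval_prog; rewrite !piE.
  rewrite -{2}(pi2_pairn (pairn w x) (pi2 w)).
  apply: eval_prec; first exact: prog_eval.
  move=> n; apply: eval_comp.
    apply: eval_pair; first by rewrite /=; reflexivity.
    apply: eval_comp; first exact: prog_eval.
    by rewrite !piE; apply: IHc.
  by apply: eval_prog; rewrite !piE.
Qed.

(** * Compilation on numbers of programs *)

Definition gpair a b := pairn 5 (pairn a b).
Definition gcomp a b := pairn 6 (pairn a b).
Definition gprec a b := pairn 7 (pairn a b).
Definition gmu a := pairn 8 a.

Definition gcompile_pair a b := gcomp (godel (prog prog_opair)) (gpair a b).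
Definition gcompile_comp a b :=
  gcomp (godel (prog prog_obind))
    (gpair b (gcomp a (gpair (godel Fst) (gcomp (godel (prog prog_pred)) b)))).
Definition gcompile_prec a b :=
  gcomp (gprec a (gcomp (godel (prog prog_obind))
         (gpair (godel (prog prog_prec_value)) (gcomp b (godel (prog prog_prec_step))))))
    (godel (prog prog_prec_init)).
Definition gcompile_mu a :=
  gcomp (godel (prog prog_pred)) (gcomp (gprec (godel (prog prog_one))
      (gcomp (godel (prog prog_search_step))
        (gpair (godel Snd) (gcomp a (godel (prog prog_search_arg))))))
    (godel (prog prog_search_init))).

Section CompileNumber.
Variable L : code.

(* [0] for the numbers that are not the number of a program *)
Definition gcompile n : nat :=
  if pselect (exists c, godel c = n) is left h
  then (godel (compile L (projT1 (cid h)))).+1 else 0.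

Lemma gcompileE c : gcompile (godel c) = (godel (compile L c)).+1.
Proof.
rewrite /gcompile; case: pselect => [h|[]]; last by exists c.
by case: cid => c' /= /godel_inj ->.
Qed.

Lemma gcompile_eq0 n : gcompile n = 0 <-> ~ exists c, godel c = n.
Proof. by rewrite /gcompile; case: pselect. Qed.

Definition gcompile1 (T : nat -> nat) u := if u == 0 then 0 else (T u.-1).+1.
Definition gcompile2 (T : nat -> nat -> nat) u v :=
  if (u == 0) || (v == 0) then 0 else (T u.-1 v.-1).+1.

Definition gcompile_step (n h : nat) : nat :=
  let t := pi1 n in let b := pi2 n in
  let get m := entry h (n - m.+1) in
  if (t <= 4) && (b == 0) then
    (if t == 0 then godel (compile L Zero) else if t == 1 then godel (compile L Succ)
     else if t == 2 then godel (compile L Fst) else if t == 3 then godel (compile L Snd)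
     else godel (compile L Query)).+1
  else if t == 5 then gcompile2 gcompile_pair (get (pi1 b)) (get (pi2 b))
  else if t == 6 then gcompile2 gcompile_comp (get (pi1 b)) (get (pi2 b))
  else if t == 7 then gcompile2 gcompile_prec (get (pi1 b)) (get (pi2 b))
  else if t == 8 then gcompile1 gcompile_mu (get b)
  else 0.

Lemma gcompile_history n m :
  m < n -> entry (history gcompile n) (n - m.+1) = gcompile m.
Proof. exact: entry_history. Qed.

Lemma ltn_pairn_l t a b : 0 < t -> a < pairn t (pairn a b).
Proof.
move=> t0; apply: leq_trans (leq_add_pairn _ _); rewrite -add1n leq_add //.
exact: leq_trans (leq_addr _ _) (leq_add_pairn _ _).
Qed.

Lemma ltn_pairn_r t a b : 0 < t -> b < pairn t (pairn a b).
Proof.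
move=> t0; apply: leq_trans (leq_add_pairn _ _); rewrite -add1n leq_add //.
exact: leq_trans (leq_addl _ _) (leq_add_pairn _ _).
Qed.

Lemma ltn_pairn t a : 0 < t -> a < pairn t a.
Proof.
by move=> t0; apply: leq_trans (leq_add_pairn _ _); rewrite -add1n leq_add.
Qed.

(** [gcompile] is defined by a classical choice, and this recursion is what makes it computable. The
    tag of a number determines the constructor; immediate subprograms have smaller numbers, so their
    compiled forms are found in the history. *)
Lemma gcompile_stepE n : gcompile n = gcompile_step n (history gcompile n).
Proof.
(* The three binary constructors are treated at once; [T] is the effect of [cop] on numbers. A
   compound number belongs to a program exactly if both components do. *)
have binary (t : nat) (op : code -> code -> code) (cop : code -> code -> code) T a b :
    (forall c d, godel (op c d) = pairn t (pairn (godel c) (godel d))) ->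
    (forall c d, compile L (op c d) = cop (compile L c) (compile L d)) ->
    (forall c d, godel (cop c d) = T (godel c) (godel d)) ->
    (forall c, godel c = pairn t (pairn a b) -> exists u v, c = op u v) ->
    gcompile (pairn t (pairn a b)) = gcompile2 T (gcompile a) (gcompile b).
  move=> gop cp gcop inv; rewrite /gcompile2.
  case: (pselect ((exists c, godel c = a) /\ (exists d, godel d = b))).
    by move=> [[c <-] [d <-]]; rewrite -gop !gcompileE cp gcop.
  move=> nab; have -> : gcompile (pairn t (pairn a b)) = 0.
    apply/gcompile_eq0 => -[c cE]; have [u [v cuv]] := inv _ cE.
    move: cE; rewrite cuv gop => /(congr1 pi2); rewrite !piE.
    move=> /[dup] /(congr1 pi1) + /(congr1 pi2).
    by rewrite !piE => ua vb; apply: nab; split; [exists u|exists v].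
  case: eqP => [//|/gcompile_eq0 na]; case: eqP => [//|/gcompile_eq0 nb].
  by case: nab; split; apply: contrapT.
have inv (t b : nat) c : godel c = pairn t b ->
    t = match c with Zero => 0 | Succ => 1 | Fst => 2 | Snd => 3 | Query => 4
        | Pair _ _ => 5 | Comp _ _ => 6 | Prec _ _ => 7 | Mu _ => 8 end.
  by move=> /(congr1 pi1); case: c => [||||| ? ? | ? ? | ? ? | ?] /=; rewrite !piE.
have -> : gcompile n = gcompile (pairn (pi1 n) (pi2 n)) by rewrite pairn_pi.
rewrite /gcompile_step.
set t := pi1 n; set b := pi2 n.
case: (ltnP 4 t) => t4 /=; last first.
  case: eqP => [->|b0].
    by case: t t4 => [|[|[|[|[|]]]]] // _; 
       [exact: (gcompileE Zero)|exact: (gcompileE Succ)|exact: (gcompileE Fst)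
       |exact: (gcompileE Snd)|exact: (gcompileE Query)].
  (* An atomic program has second component [0], so this number belongs to no program. *)
  have -> : gcompile (pairn t b) = 0.
    apply/gcompile_eq0 => -[c cE]; apply: b0; have tE := inv _ _ _ cE.
    move: cE => /(congr1 pi2); rewrite piE => <-.
    by case: c tE t4 => [||||| ? ? | ? ? | ? ? | ?] /= -> //; rewrite piE.
  by case: t t4 => [|[|[|[|[|]]]]].
have bin_args : b = pairn (pi1 b) (pi2 b) by rewrite pairn_pi.
have nE : n = pairn t (pairn (pi1 b) (pi2 b)) by rewrite -bin_args pairn_pi.
have t0 : 0 < t by apply: leq_trans t4.
have l1 : pi1 b < n by rewrite [ltnRHS]nE ltn_pairn_l.
have l2 : pi2 b < n by rewrite [ltnRHS]nE ltn_pairn_r.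
have l3 : b < n by rewrite [ltnRHS]nE -bin_args ltn_pairn.
rewrite !gcompile_history //.
case: (t =P 5) => [->|t5].
  rewrite {1}bin_args; apply: (binary 5 Pair compile_pair) => //.
  by move=> c /inv; case: c => // u v _; exists u, v.
case: (t =P 6) => [->|t6].
  rewrite {1}bin_args; apply: (binary 6 Comp compile_comp) => //.
  by move=> c /inv; case: c => // u v _; exists u, v.
case: (t =P 7) => [->|t7].
  rewrite {1}bin_args; apply: (binary 7 Prec compile_prec) => //.
  by move=> c /inv; case: c => // u v _; exists u, v.
case: (t =P 8) => [->|t8].
  rewrite /gcompile1; case: (pselect (exists c, godel c = b)) => [[c <-]|nb].
    by rewrite -[pairn 8 _]/(godel (Mu c)) !gcompileE.
  have /gcompile_eq0 -> := nb; apply/gcompile_eq0 => -[c cE]; apply: nb.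
  move: (cE) => /inv; case: c cE => // c /= /(congr1 pi2).
  by rewrite !piE => cb _; exists c.
apply/gcompile_eq0 => -[c /inv].
by case: c => [||||| ? ? | ? ? | ? ? | ?] tE; move: t4 t5 t6 t7 t8; rewrite tE.
Qed.

Lemma computable_gcompile O : computable O gcompile.
Proof.
apply: (@computable_course_of_values _ _ (fun y => gcompile_step (pi1 y) (pi2 y))).
  rewrite /gcompile_step /gcompile1 /gcompile2 /gcompile_pair /gcompile_comp
    /gcompile_prec /gcompile_mu /gcomp /gpair /gprec /gmu; comp.
by move=> n; rewrite !piE; apply: gcompile_stepE.
Qed.

End CompileNumber.

(** * A halting problem for compiled programs *)

Section SearchIndex.
Variables (L : code) (V : nat -> nat -> bool).
Hypothesis computableV : computable setT (fun y => V (pi1 y) (pi2 y)).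

(** Constant programs hard-wire an argument, as in the s-m-n theorem: membership in the jump runs a
    program on its own number, and that input must be ignored. *)
Fixpoint numeral k : code := if k is k'.+1 then Comp Succ (numeral k') else Zero.

Lemma eval_numeral A k x : eval A (numeral k) x k.
Proof. by elim: k => [//|k IHk] /=; exists k. Qed.

Definition witness_test : computable setT (fun y => ~~ ((pi1 y != 0) && (pi2 y != 0))).
Proof. comp. Qed.
(* ((q, n), w) goes to (q, w), respectively to (w, n) *)
Definition witness_fst : computable setT (fun y => pairn (pi1 (pi1 y)) (pi2 y)).
Proof. comp. Qed.
Definition witness_snd : computable setT (fun y => pairn (pi2 y) (pi2 (pi1 y))).
Proof. comp. Qed.

(** A witness [w] pairs the index of a piece of partial information with a search bound, so one [Mu]
    ranges over both. The test is negated because [Mu] looks for a zero. *)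
Definition witness_search (t : code) : code :=
  Mu (Comp (prog witness_test)
    (Pair (Comp (prog computableV) (prog witness_fst)) (Comp t (prog witness_snd)))).

Definition gwitness_search (t : nat) : nat :=
  gmu (gcomp (godel (prog witness_test))
    (gpair (gcomp (godel (prog computableV)) (godel (prog witness_fst)))
           (gcomp t (godel (prog witness_snd))))).

(** If [n] is not the number of a program, the index is that of a program that halts nowhere. *)
Definition search_index q n : nat :=
  if gcompile L n == 0 then godel (Mu (Comp Succ Zero))
  else gcomp (gwitness_search (gcompile L n).-1) (godel (numeral (pairn q n))).

Lemma computable_search_index O :
  computable O (fun y => search_index (pi1 y) (pi2 y)).
Proof.
apply: computable_if.
- by apply: computable_eqn; [apply: computable_comp (computable_gcompile L O) _|]; comp.
- comp.
- rewrite /gwitness_search /gcomp /gmu /gpair.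
  have cc : computable O (fun y => gcompile L (pi2 y)).
    by apply: (computable_comp (f := gcompile L)); [apply: computable_gcompile|comp].
  have cn : computable O (fun y => godel (numeral (pairn (pi1 y) (pi2 y)))).
    apply: (computable_comp (f := fun k => godel (numeral k))); last comp.
    apply: (@computable_eq _ (fun k => iteri k (fun _ z => gcomp (godel Succ) z) (godel Zero))).
      by elim=> //= k ->.
    by apply: computable_iteri; rewrite /gcomp; comp.
  comp.
Qed.

Lemma eval_Mu_total A c x (f : nat -> nat) :
    (forall m, eval A c (pairn x m) (f m)) ->
  (exists y, eval A (Mu c) x y) <-> exists m, f m = 0.
Proof.
move=> cf; split=> [[y [cy _]]|[m fm]].
  by exists y; apply: eval_fun cy.
have ex : exists m, f m == 0 by exists m; apply/eqP.
case: (ex_minnP ex) => y /eqP fy ymin; exists y; split; first by rewrite -fy.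
move=> k ky; case e: (f k) => [|j]; last by exists j; rewrite -e.
by have := ymin k; rewrite e => /(_ isT); rewrite leqNgt ky.
Qed.

(** The program with this index ignores its input and searches for [w] on [(q, n)]. The tested
    function is total, so the search halts exactly if a witness exists. *)
Lemma search_indexP (l : nat -> nat -> nat) q n :
    (forall A q z, eval A L (pairn q z) (l q z)) ->
  jump set0 (search_index q n) <->
  exists c, godel c = n /\
    exists2 w, V q w & bounded_eval (l (pi1 w)) (pi2 w) c n != 0.
Proof.
move=> LP; rewrite /search_index.
case: eqP => [/gcompile_eq0 nn|].
  split=> [[y [c /godel_inj ->]]|[c [cn _]]]; last by case: nn; exists c.
  by move=> [[z -> ] /=].
case: (pselect (exists c, godel c = n)) => [[c cn]|/gcompile_eq0 //] _.
rewrite -{1}cn gcompileE succnK.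
have -> : gcomp (gwitness_search (godel (compile L c))) (godel (numeral (pairn q n)))
    = godel (Comp (witness_search (compile L c)) (numeral (pairn q n))) by [].
set e := godel _.
pose g w := nat_of_bool (~~ (((V q w : nat) != 0) && (bounded_eval (l (pi1 w)) (pi2 w) c n != 0))).
have total A : (exists y, eval A (witness_search (compile L c)) (pairn q n) y) <->
    exists w, g w = 0.
  apply: eval_Mu_total => w; apply: eval_comp.
    apply: eval_pair.
      by apply: eval_comp; [apply: prog_eval|rewrite !piE; apply: prog_eval].
    by apply: eval_comp; [apply: prog_eval|rewrite !piE; apply: eval_compile].
  by apply: eval_prog; rewrite !piE.
transitivity (exists w, g w = 0).
  rewrite -(total set0); split.
    move=> [y [c' /godel_inj ->]] [z zP yP]; exists y.
    by rewrite (eval_fun (eval_numeral set0 (pairn q n) e) zP).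
  move=> [y yP]; exists y; exists (Comp (witness_search (compile L c)) (numeral (pairn q n))) => //.
  by exists (pairn q n) => //; apply: eval_numeral.
split=> [[w]|[c' [c'n [w Vw]]]].
  rewrite /g; case Vw: (V q w) => //=; case e0: (_ != 0) => //= _.
  by exists c; split=> //; exists w.
move: c'n; rewrite -cn => /godel_inj -> bw.
by exists w; rewrite /g Vw /= -cn bw.
Qed.

End SearchIndex.

(** * Conditions *)

Lemma prefix_nth (s t : seq bool) :
  prefix s t <-> size s <= size t /\ forall x, x < size s -> nth false t x = nth false s x.
Proof.
rewrite prefixE; split=> [/eqP e|[le h]].
  have le : size s <= size t by rewrite -e size_take; case: ltnP => // /ltnW.
  by split=> // x xs; rewrite -[in RHS]e nth_take.
apply/eqP; apply: (@eq_from_nth _ false) => [|x]; rewrite size_takel // => xs.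
by rewrite nth_take // h.
Qed.

Lemma extends_refl p : extends p p.
Proof.
split=> // [i _|i b _ _ x /andP[h]]; first exact: prefix_refl.
by rewrite ltnNge h.
Qed.

Lemma extends_trans p q r : extends r q -> extends q p -> extends r p.
Proof.
move=> [sqr lqr pqr fqr] [spq lpq ppq fpq].
have lt i : i < size p -> i < size q by move=> ip; apply: leq_trans spq.
split.
- exact: leq_trans sqr.
- by move=> i ip; rewrite lqr ?lt // lpq.
- by move=> i ip; apply: prefix_trans (ppq i ip) (pqr i (lt _ ip)).
- move=> i b ip lb x /andP[px xr]; case: (ltnP x (size (stem q i))) => xq.
    have /prefix_nth[_ ->] // := pqr i (lt _ ip).
    by apply: fpq lb _ _ => //; rewrite px.
  by apply: fqr; rewrite ?lt ?lpq // xq.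
Qed.

Lemma forcing_filter_common G p q : forcing_filter G -> G p -> G q ->
  exists r, [/\ G r, extends r p & extends r q].
Proof. by move=> [_ _]; apply. Qed.

Definition long k : set cond :=
  [set p | k <= size p /\ forall i, i < k -> k <= size (stem p i)].

(** Appending [k] bits that obey the lock lengthens every string. *)
Lemma dense_long k : forcing_dense (long k).
Proof.
move=> p.
(* Beyond [size p] the default of [nth] supplies an empty stem and the lock u, so new coordinates
   arise by the same formula. *)
pose b i := if lck p i is Some b then b else false.
pose st i := stem p i ++ nseq k (b i).
pose q : cond := mkseq (fun i => (st i, lck p i)) (maxn k (size p)).
have qst i : i < size q -> stem q i = st i.
  by rewrite size_mkseq => iq; rewrite /stem nth_mkseq.
have qlck i : i < size q -> lck q i = lck p i.
  by rewrite size_mkseq => iq; rewrite /lck nth_mkseq.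
have pq i : i < size p -> i < size q.
  by rewrite size_mkseq leq_max orbC => ->.
exists q; split.
- by rewrite size_mkseq leq_maxl.
- move=> i ik; rewrite qst ?size_mkseq ?(leq_trans ik (leq_maxl _ _)) //.
  by rewrite size_cat size_nseq leq_addl.
- by rewrite size_mkseq leq_maxr.
- by move=> i /pq /qlck.
- by move=> i /pq /qst ->; apply: prefix_prefix.
- move=> i v /pq ip pv x; rewrite qst // size_cat size_nseq => /andP[h1 h2].
  rewrite nth_cat ltnNge h1 /= nth_nseq /b pv.
  by rewrite ltn_subLR // h2.
Qed.

(** What [p] settles about the oracle built from the generic, in the format of [bounded_eval]: odd
    questions concern the graph of the lock function, even ones the sets, and [0] means not settled
    yet. *)
Definition answer (p : cond) (z : nat) : nat :=
  let i := pi1 z./2 in let x := pi2 z./2 in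
  if odd z then (if i < size p then (x == lock_num (lck p i)).+1 else 0)
  else if (i < size p) && (x < size (stem p i)) then (nth false (stem p i) x).+1 else 0.

Lemma answer_mono p q z b : extends q p -> answer p z = b.+1 -> answer q z = b.+1.
Proof.
move=> [sz lk pre _]; rewrite /answer.
case: (ltnP (pi1 z./2) (size p)) => [ip|]; last by case: odd.
have iq := leq_trans ip sz; rewrite iq lk //=; case: odd => //.
have /prefix_nth[lpq pq] := pre _ ip.
by case: ltnP => // xp; rewrite (leq_trans xp lpq) pq.
Qed.

Section Filter.
Variable G : set cond.
Hypothesis GF : forcing_filter G.
Let Z := join (RvecG G) (fG_set G).

(** Any condition of [G] that testifies about [z] has a common extension with [p] in [G], so the two
    cannot disagree. *)
Lemma answer_sound p z : G p ->
  (answer p z = 1 -> ~ Z z) /\ (forall b, answer p z = b.+2 -> Z z /\ b = 0).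
Proof.
move=> Gp; rewrite /answer /Z /join /=; case: odd.
  case: ltnP => // ip.
  have fp : fG G (pi1 z./2) (lck p (pi1 z./2)) by exists p.
  case: eqP => [e|e]; split=> //.
  - by move=> b [<-]; split=> //; exists (lck p (pi1 z./2)).
  - move=> _ [v [q [Gq iq lq]] vE]; apply: e; rewrite vE; congr lock_num.
  have [r [Gr [_ rp _ _] [_ rq _ _]]] := forcing_filter_common GF Gp Gq.
  by rewrite -rp // rq // lq.
case: ifP => // /andP[ip xp].
case e : (nth _ _ _) => /=; split=> //.
  by move=> b [<-]; split=> //; exists p.
move=> _ [q [Gq iq xq]].
have [r [Gr [_ _ rp _] [_ _ rq _]]] := forcing_filter_common GF Gp Gq.
have /prefix_nth[_ h1] := rp _ ip; have /prefix_nth[_ h2] := rq _ iq.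
by rewrite -h2 // h1 // e.
Qed.

Hypothesis Glong : forall k, G `&` long k !=set0.

Lemma answer_complete s :
  exists2 p, G p & forall z b, initial_answers Z s z = b.+1 -> answer p z = b.+1.
Proof.
have [p [Gp [sz ln]]] := Glong s; exists p => // z b.
rewrite /initial_answers; case: ltnP => // zs [<-].
(* Both components of a pair are bounded by its number, so a condition in [long s] settles all
   questions below [s]. *)
have hz : pi1 z./2 + pi2 z./2 < s.
  apply: leq_ltn_trans zs; apply: (@leq_trans z./2).
    by rewrite -{3}(pairn_pi z./2) leq_add_pairn.
  by rewrite -{2}(odd_double_half z) -addnn addnA leq_addl.
have i_s : pi1 z./2 < s by apply: leq_ltn_trans hz; apply: leq_addr.
have x_s : pi2 z./2 < s by apply: leq_ltn_trans hz; apply: leq_addl.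
have nz : answer p z != 0.
  rewrite /answer (leq_trans i_s sz) (leq_trans x_s (ln _ i_s)).
  by case: odd.
have [s1 s2] := answer_sound z Gp.
case e: (answer p z) nz => [|[|k]] // _.
  by rewrite asboolF //; apply: s1.
by have [Zz ->] := s2 _ e; rewrite asboolT.
Qed.

End Filter.

(** * Forcing the jump *)

(** The halting computation is already determined by the finite information in [p], which makes this
    a Sigma_1 property. *)
Definition forces_in (p : cond) n : Prop :=
  exists c, godel c = n /\ exists s, bounded_eval (answer p) s c n != 0.

Definition forces_in_later (p : cond) n : Prop :=
  exists2 q, extends q p & forces_in q n.

(** The forcing relation for the jump is put in the format of partial oracle information, so that
    [bounded_eval] can run functionals of the jump on it. Here [0] means that [p] leaves the
    question open. *)
Definition jump_answer (p : cond) n : nat :=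
  if `[< forces_in p n >] then 2 else if `[< forces_in_later p n >] then 0 else 1.

Lemma forces_in_mono p q n : extends q p -> forces_in p n -> forces_in q n.
Proof.
move=> qp [c [cn [s sP]]]; exists c; split=> //; exists s.
case e: (bounded_eval _ _ _ _) sP => [|y] // _.
by rewrite (bounded_eval_mono _ (leqnn s) e) // => z b; apply: answer_mono.
Qed.

Lemma jump_answer1 p n : jump_answer p n = 1 <-> ~ forces_in_later p n.
Proof.
rewrite /jump_answer; split.
  by case: asboolP => // _; case: asboolP.
move=> np; rewrite asboolF; last by move=> fp; apply: np; exists p => //; apply: extends_refl.
by rewrite asboolF.
Qed.

Lemma jump_answer2 p n b : jump_answer p n = b.+2 <-> forces_in p n /\ b = 0.
Proof.
rewrite /jump_answer; case: asboolP => [fp|nfp].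
  by split=> [[<-]|[_ ->]].
by split=> [|[]] //; case: asboolP.
Qed.

Lemma jump_answer_mono p q n b :
  extends q p -> jump_answer p n = b.+1 -> jump_answer q n = b.+1.
Proof.
move=> qp; case: b => [|b].
  move=> /jump_answer1 np; apply/jump_answer1 => -[r rq fr].
  by apply: np; exists r => //; apply: extends_trans qp.
by move=> /jump_answer2[/(forces_in_mono qp) fq ->]; apply/jump_answer2.
Qed.

Definition decides n : set cond := [set p | jump_answer p n != 0].

Lemma dense_decides n : forcing_dense (decides n).
Proof.
move=> p; case: (pselect (forces_in_later p n)) => [[q qp fq]|np].
  exists q => //; rewrite /decides /=.
  by have /jump_answer2 -> : forces_in q n /\ 0 = 0.
exists p; last exact: extends_refl.
by rewrite /decides /=; have /jump_answer1 -> := np.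
Qed.

Section FilterJump.
Variable G : set cond.
Hypothesis GF : forcing_filter G.
Hypothesis Glong : forall k, G `&` long k !=set0.
Hypothesis Gdecides : forall n, G `&` decides n !=set0.
Let Z := join (RvecG G) (fG_set G).

(** If [n] entered the jump, the finitely many answers used would come from a condition of [G]; its
    common extension with [p] would force [n] in, against the answer [1]. *)
Lemma jump_answer_sound p n : G p ->
  (jump_answer p n = 1 -> ~ jump Z n) /\
  (forall b, jump_answer p n = b.+2 -> jump Z n /\ b = 0).
Proof.
move=> Gp; split=> [/jump_answer1 np [y [c cn /bounded_eval_complete[s sP]]]|b].
  have [q Gq qP] := answer_complete GF Glong s.
  have [r [Gr rp rq]] := forcing_filter_common GF Gp Gq.
  apply: np; exists r => //; exists c; split=> //; exists s.
  rewrite (@bounded_eval_mono _ (answer r) _ s _ _ _ _ _ sP) // => z b zb.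
  by apply: answer_mono rq _; apply: qP.
move=> /jump_answer2[[c [cn [s sP]]] ->]; split=> //.
case e: (bounded_eval _ _ _ _) sP => [|y] // _; exists y; exists c => //.
apply: bounded_eval_sound e => z; first by case: (answer_sound GF z Gp).
by move=> b'; case: (answer_sound GF z Gp) => _; apply.
Qed.

(** Conditions of [G] that decide the numbers below [s] are amalgamated one by one. Staying below
    [p] is what later contradicts forced divergence. *)
Lemma jump_answer_complete p s : G p ->
  exists2 q, G q /\ extends q p &
    forall n b, initial_answers (jump Z) s n = b.+1 -> jump_answer q n = b.+1.
Proof.
move=> Gp; elim: s => [|s [q [Gq qp] qP]].
  by exists p => //; split=> //; apply: extends_refl.
have [q' [Gq' q's]] := Gdecides s.
have [r [Gr rq rq']] := forcing_filter_common GF Gq Gq'.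
exists r; first by split=> //; apply: extends_trans qp.
move=> n b; rewrite /initial_answers ltnS leq_eqVlt.
case: eqP => [-> /= [<-]|_ /= nb]; last first.
  by apply: jump_answer_mono rq _; apply: qP.
have [s1 s2] := jump_answer_sound s Gq'.
have {}q's : jump_answer q' s != 0 by [].
case e: (jump_answer q' s) q's => [|[|k]] // _.
  by rewrite asboolF; [apply: jump_answer_mono rq' e|apply: s1].
have [Zs k0] := s2 _ e; rewrite asboolT //.
by apply: jump_answer_mono rq' _; rewrite e k0.
Qed.

End FilterJump.

(** * Numbers of conditions *)

Section Decode.
Implicit Types (q i x : nat).

(** Item [i] is the triple of lock, length and bits. Stray values are normalised, so every number
    codes a condition and searches need no validity check. *)
Let item q i : nat := entry (pi2 q) i.
Definition lockn q i : nat := if pi1 (item q i) <= 1 then pi1 (item q i) else 2.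
Definition lenn q i : nat := pi1 (pi2 (item q i)).
Definition bitn q i x : bool := 0 < entry (pi2 (pi2 (item q i))) x.

Definition lock_of (v : nat) : Defs.lock :=
  match v with 0 => Some false | 1 => Some true | _ => None end.

Definition decode q : cond :=
  mkseq (fun i => (mkseq (bitn q i) (lenn q i), lock_of (lockn q i))) (pi1 q).

Lemma size_decode q : size (decode q) = pi1 q.
Proof. exact: size_mkseq. Qed.

Lemma stem_decode q i : i < pi1 q -> stem (decode q) i = mkseq (bitn q i) (lenn q i).
Proof. by move=> iq; rewrite /stem nth_mkseq. Qed.

Lemma lock_of_num v : lock_of (lock_num v) = v.
Proof. by case: v => [[]|]. Qed.

Lemma lck_decode q i : i < pi1 q -> lck (decode q) i = lock_of (lockn q i).
Proof. by move=> iq; rewrite /lck nth_mkseq. Qed.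

Lemma lock_num_lck_decode q i : i < pi1 q -> lock_num (lck (decode q) i) = lockn q i.
Proof.
by move=> iq; rewrite lck_decode // /lockn; case: (pi1 _) => [|[]].
Qed.

Lemma decode_surj p : exists q, decode q = p.
Proof.
have [bits bitsP] : exists bits : nat -> nat, forall i x, x < size (stem p i) ->
    entry (bits i) x = nth false (stem p i) x.
  have /choice[bits bitsP] : forall i, exists t, forall x, x < size (stem p i) ->
      entry t x = nth false (stem p i) x by move=> i; apply: entryP.
  by exists bits.
have [t tP] := entryP
  (fun i => pairn (lock_num (lck p i)) (pairn (size (stem p i)) (bits i))) (size p).
exists (pairn (size p) t).
apply: (@eq_from_nth _ ([::], None)) => [|i]; rewrite size_decode piE // => ip.
rewrite nth_mkseq ?piE // [RHS]surjective_pairing; congr pair.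
  rewrite /lenn /bitn /item piE tP // !piE.
  apply: (@eq_from_nth _ false) => [|x]; rewrite size_mkseq // => xs.
  by rewrite nth_mkseq // bitsP // lt0b.
by rewrite /lockn /item piE tP // piE -[RHS]lock_of_num /lck; case: (nth _ _ _).2 => [[]|].
Qed.

Variable O : set (set nat).

Lemma computable_lockn f g :
  computable O f -> computable O g -> computable O (fun y => lockn (f y) (g y)).
Proof. rewrite /lockn /item; comp. Qed.

Lemma computable_lenn f g :
  computable O f -> computable O g -> computable O (fun y => lenn (f y) (g y)).
Proof. rewrite /lenn /item; comp. Qed.

Lemma computable_bitn f g h :
    computable O f -> computable O g -> computable O h ->
  computable O (fun y => bitn (f y) (g y) (h y)).
Proof. rewrite /bitn /item; comp. Qed.

End Decode.
#[local] Hint Resolve computable_lockn computable_lenn computable_bitn : comp.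

Lemma computable_answer O : computable O (fun y => answer (decode (pi1 y)) (pi2 y)).
Proof.
apply: (@computable_eq _ (fun y =>
  let q := pi1 y in let z := pi2 y in let i := pi1 z./2 in let x := pi2 z./2 in
  if odd z then (if i.+1 <= pi1 q then ((x == lockn q i) : nat).+1 else 0)
  else if (i.+1 <= pi1 q) && (x.+1 <= lenn q i) then (bitn q i x : nat).+1 else 0)); last comp.
move=> y; rewrite /answer size_decode /=.
case: ltnP => [iq|]; last by case: odd.
rewrite lock_num_lck_decode // stem_decode // size_mkseq.
by case: odd => //=; case: ltnP => // xl; rewrite nth_mkseq.
Qed.

(** All quantifiers in [extends] are bounded by sizes of the conditions, hence the relation is
    decidable on numbers. *)
Definition extendsb q p : bool :=
  (pi1 p <= pi1 q) && all (fun i =>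
    [&& lockn q i == lockn p i, lenn p i <= lenn q i,
        all (fun x => (bitn q i x : nat) == bitn p i x) (iota 0 (lenn p i)) &
        (lockn p i == 2) || all (fun x => (x.+1 <= lenn p i) || ((bitn q i x : nat) == lockn p i))
                             (iota 0 (lenn q i))]) (iota 0 (pi1 p)).

Lemma all_iotaP (P : nat -> bool) n :
  reflect (forall x, x < n -> P x) (all P (iota 0 n)).
Proof.
by apply: (iffP allP) => h x; [move=> xn; apply: h; rewrite mem_iota|rewrite mem_iota; apply: h].
Qed.

Lemma extendsbP q p : extendsb q p <-> extends (decode q) (decode p).
Proof.
have lock_lt n i : lockn n i = 2 \/ exists b : bool, lockn n i = b.
  rewrite /lockn; case: (pi1 _) => [|[|k]]; last by left.
    by right; exists false.
  by right; exists true.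
have stem_prefix i : i < pi1 p -> i < pi1 q ->
    prefix (stem (decode p) i) (stem (decode q) i) <->
    lenn p i <= lenn q i /\ forall x, x < lenn p i -> bitn q i x = bitn p i x.
  move=> ip iq; rewrite prefix_nth !stem_decode // !size_mkseq.
  split=> -[le h]; split=> // x xp; have := h x xp; rewrite !nth_mkseq //.
    exact: leq_trans xp le.
  exact: leq_trans xp le.
split=> [/andP[sz /all_iotaP h]|[]].
  have iq i : i < pi1 p -> i < pi1 q by move=> ip; apply: leq_trans sz.
  split; rewrite ?size_decode // => i.
  - by move=> ip; have /and4P[/eqP e _ _ _] := h i ip; rewrite !lck_decode ?iq // e.
  - move=> ip; have /and4P[_ le /all_iotaP e _] := h i ip.
    apply/stem_prefix => //; first exact: iq.
    by split=> // x xp; have := e x xp; case: (bitn q i x); case: (bitn p i x).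
  - move=> b ip lb x; rewrite !stem_decode ?iq // !size_mkseq => /andP[xp xq].
    have lpb : lockn p i = b by rewrite -lock_num_lck_decode // lb.
    have /and4P[_ _ _ /orP[|/all_iotaP e]] := h i ip; first by rewrite lpb; case: (b).
    rewrite nth_mkseq //; have := e x xq; rewrite ltnNge xp /= lpb.
    by case: (bitn _ _ _); case: (b).
rewrite !size_decode => sz lk pre fr.
have iq i : i < pi1 p -> i < pi1 q by move=> ip; apply: leq_trans sz.
rewrite /extendsb sz; apply/all_iotaP => i ip.
have /stem_prefix [//||le e] := pre i ip; first exact: iq.
rewrite le -!lock_num_lck_decode ?iq // lk // eqxx /=; apply/andP; split.
  by apply/all_iotaP => x xp; rewrite e.
case l: (lck _ _) => [b|//]; apply/orP; right.
apply/all_iotaP => x xq; case: ltnP => //= px.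
have := fr i b ip l x; rewrite !stem_decode ?iq // !size_mkseq px xq => /(_ isT).
by rewrite nth_mkseq // => ->.
Qed.

Lemma computable_extendsb O f g :
  computable O f -> computable O g -> computable O (fun y => extendsb (f y) (g y)).
Proof.
move=> cf cg; apply: computable_and; first comp.
(* [computable_all] takes a single parameter, so the two numbers are passed as the pair [a]. *)
pose P a i :=
    [&& lockn (pi1 a) i == lockn (pi2 a) i, lenn (pi2 a) i <= lenn (pi1 a) i,
        all (fun x => (bitn (pi1 a) i x : nat) == bitn (pi2 a) i x) (iota 0 (lenn (pi2 a) i)) &
        (lockn (pi2 a) i == 2) ||
        all (fun x => (x.+1 <= lenn (pi2 a) i) || ((bitn (pi1 a) i x : nat) == lockn (pi2 a) i))
          (iota 0 (lenn (pi1 a) i))].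
pose Q z := all (P z) (iota 0 (pi1 (pi2 z))).
apply: (@computable_eq _ (fun y => Q (pairn (f y) (g y)))) => [y|].
  by rewrite /Q /P !piE.
apply: (computable_comp (f := Q)); last comp.
apply: computable_all; last comp.
apply: computable_and; first comp.
apply: computable_and; first comp.
apply: computable_and.
  apply: (computable_all (p := fun y x =>
    (bitn (pi1 (pi1 y)) (pi2 y) x : nat) == bitn (pi2 (pi1 y)) (pi2 y) x)); comp.
apply: computable_or; first comp.
apply: (computable_all (p := fun y x => (x.+1 <= lenn (pi2 (pi1 y)) (pi2 y)) ||
  ((bitn (pi1 (pi1 y)) (pi2 y) x : nat) == lockn (pi2 (pi1 y)) (pi2 y)))); comp.
Qed.

Lemma computable_query A f :
  computable [set A] f -> computable [set A] (fun x => `[< A (f x) >]).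
Proof.
move=> cf; apply: (computable_comp (f := fun z => `[< A z >] : nat)) cf.
exists Query => _ -> x /=.
by case: asboolP; [left|right].
Qed.

(* Both questions of [jump_answer] are questions to [jump set0] about a search
   for a fuelled run of a program. *)
Lemma computable_jump_answer :
  computable [set jump set0] (fun y => jump_answer (decode (pi1 y)) (pi2 y)).
Proof.
have [L LP] := computable_answer setT.
have LE A q z : eval A L (pairn q z) (answer (decode q) z).
  by have := LP A I (pairn q z); rewrite !piE.
(* [V1] admits only the information given by [q] itself, for [forces_in]; [V2] admits that of any
   extension, for [forces_in_later]. *)
pose V1 (q w : nat) := pi1 w == q; pose V2 q w := extendsb (pi1 w) q.
have cV1 : computable setT (fun y => V1 (pi1 y) (pi2 y)) by rewrite /V1; comp.
have cV2 : computable setT (fun y => V2 (pi1 y) (pi2 y)).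
  by apply: computable_extendsb; comp.
have idx (V : nat -> nat -> bool) (cV : computable setT (fun y => V (pi1 y) (pi2 y))) :=
  computable_query (computable_search_index L cV [set jump set0]).
apply: (@computable_eq _ (fun y =>
  if `[< jump set0 (search_index L cV1 (pi1 y) (pi2 y)) >] then 2
  else if `[< jump set0 (search_index L cV2 (pi1 y) (pi2 y)) >] then 0 else 1)).
  move=> y; rewrite /jump_answer.
  have -> : `[< jump set0 (search_index L cV1 (pi1 y) (pi2 y)) >]
      = `[< forces_in (decode (pi1 y)) (pi2 y) >].
    apply: asbool_equiv_eq; apply: iff_trans (search_indexP cV1 _ _ LE) _; split.
      by move=> [c [cn [w /eqP <- bw]]]; exists c; split=> //; exists (pi2 w).
    move=> [c [cn [s sP]]]; exists c; split=> //.
    by exists (pairn (pi1 y) s); rewrite /V1 !piE.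
  have -> // : `[< jump set0 (search_index L cV2 (pi1 y) (pi2 y)) >]
      = `[< forces_in_later (decode (pi1 y)) (pi2 y) >].
  apply: asbool_equiv_eq; apply: iff_trans (search_indexP cV2 _ _ LE) _; split.
    move=> [c [cn [w Vw bw]]]; exists (decode (pi1 w)); first exact/extendsbP.
    by exists c; split=> //; exists (pi2 w).
  move=> [r + [c [cn [s sP]]]]; have [q qr] := decode_surj r.
  rewrite -qr in sP *; move=> /extendsbP Vq; exists c; split=> //.
  by exists (pairn q s); rewrite /V2 !piE.
by apply: computable_if; [exact: idx|comp|apply: computable_if; [exact: idx| |]; comp].
Qed.

(** * Avoiding diagonally non-computable functions *)

Definition forces_divergence (c : code) (p : cond) : Prop :=
  exists x, forall q s, extends q p -> bounded_eval (jump_answer q) s c x = 0.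

(** The functional [c] of the jump takes at [x] the diagonal value relative to [jump set0], so it is
    not diagonally non-computable. *)
Definition forces_agreement (c : code) (p : cond) : Prop :=
  exists x y s, bounded_eval (jump_answer p) s c x = y.+1 /\ phi (jump set0) x x y.

Definition avoids (c : code) : set cond :=
  [set p | forces_divergence c p \/ forces_agreement c p].

(* If no condition below [p] forces divergence, then searching for a condition
   that forces convergence is a total function computable from [jump set0]; it
   agrees with the diagonal at its own index. *)
Lemma dense_avoids c : forcing_dense (avoids c).
Proof.
move=> p; case: (pselect (forces_divergence c p)) => [dp|ndp].
  by exists p; [left|apply: extends_refl].
have [p0 p0E] := decode_surj p.
have [L LP] := computable_jump_answer.
have LE q z : eval (jump set0) L (pairn q z) (jump_answer (decode q) z).
  by have := LP _ erefl (pairn q z); rewrite !piE.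
pose E w x := bounded_eval (jump_answer (decode (pi1 w))) (pi2 w) c x.
have cE : computable [set jump set0] (fun y => E (pi1 y) (pi2 y)).
  exists (compile L c) => _ -> y.
  by have := eval_compile c (pi1 y) (pi2 y) LE; rewrite pairn_pi.
(* The value is [0] exactly if [w] pairs the number of an extension of [p] with a bound at which [c]
   converges on [x]. *)
pose test x w := ~~ (extendsb (pi1 w) p0 && ~~ (E w x == 0)).
have [T TP] : computable [set jump set0] (fun y => test (pi1 y) (pi2 y)).
  apply: computable_neg; apply: computable_and.
    by apply: computable_extendsb; comp.
  apply: computable_neg; apply: computable_eqn; last comp.
  pose sw y := pairn (pi2 y) (pi1 y).
  apply: (@computable_eq _ (fun y => E (pi1 (sw y)) (pi2 (sw y)))).
    by move=> y; rewrite !piE.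
  by apply: (computable_comp (f := fun y => E (pi1 y) (pi2 y))) => //; rewrite /sw; comp.
have [P PP] : computable [set jump set0] (fun y => (E (pi1 y) (pi2 y)).-1).
  exact: computable_pred.
(* This program sends [x] to the value forced by the first successful [w]; [Pair Fst Snd] passes [x]
   along. It does not mention its own number, so no fixed point is needed: it is simply run at
   [a]. *)
pose a := godel (Comp P (Pair (Mu T) (Pair Fst Snd))).
have found : exists w, (test a w : nat) = 0.
  have [w] : exists w, extendsb (pi1 w) p0 /\ E w a != 0.
    apply: contrapT => nw; apply: ndp; exists a => q s qp.
    have [q0 q0E] := decode_surj q; apply/eqP; apply: contrapT => /negP sP.
    apply: nw; exists (pairn q0 s); rewrite /E !piE q0E; split=> //.
    by apply/extendsbP; rewrite q0E p0E.
  by move=> [e1 e2]; exists w; rewrite /test e1 e2.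
have TE x w : eval (jump set0) T (pairn x w) (test x w).
  by have := TP _ erefl (pairn x w); rewrite !piE.
have [w wP] := (eval_Mu_total (TE a)).2 found.
have w0 : (test a w : nat) = 0 := eval_fun (TE a w) wP.1.
have /andP[ext Ew] : extendsb (pi1 w) p0 && (E w a != 0) by move: w0; rewrite /test; case: andb.
exists (decode (pi1 w)); last by rewrite -p0E; apply/extendsbP.
right; exists a, (E w a).-1, (pi2 w); split.
  by rewrite -/(E w a) prednK // lt0n.
exists (Comp P (Pair (Mu T) (Pair Fst Snd))) => //.
apply: (eval_comp (z := pairn w a)).
  apply: eval_pair => //; rewrite -{2}(pairn_pi a); exact: eval_pair.
by have := PP _ erefl (pairn w a); rewrite !piE.
Qed.

Theorem theorem3p3 :
  exists D : set (set cond),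
    [/\ countable D,
        forall S : set cond, D S -> forcing_dense S &
        forall G : set cond, forcing_filter G ->
          (forall S : set cond, D S -> G `&` S !=set0) ->
          ~ PA_relative_to (jump set0) (jump (join (RvecG G) (fG_set G)))].
Proof.
(* The first component of [n] selects the family. A number that belongs to no program contributes
   the set of all conditions. *)
pose D n := if pi1 n == 0 then long (pi2 n) else if pi1 n == 1 then decides (pi2 n)
  else [set p | forall c, godel c = pi2 n -> avoids c p].
exists (range D); split.
- exact: card_le_trans (card_image_le _ _) (countableP _).
- move=> _ [n _ <-]; rewrite /D; case: eqP => _; first exact: dense_long.
  case: eqP => _; first exact: dense_decides.
  case: (pselect (exists c, godel c = pi2 n)) => [[c cn] p|nn p].
    have [q qc qp] := dense_avoids c p; exists q => // c'.
    by rewrite -cn => /godel_inj ->.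
  by exists p; [move=> c cn; case: nn; exists c|apply: extends_refl].
move=> G GF GD.
have GDn n : G `&` D n !=set0 by apply: GD; exists n.
have Glong k : G `&` long k !=set0 by have := GDn (pairn 0 k); rewrite /D !piE.
have Gdecides k : G `&` decides k !=set0 by have := GDn (pairn 1 k); rewrite /D !piE.
move=> [g [[e ge] gDNC]].
(* [computes] offers a program for each argument separately; all have the number [e], so injectivity
   of [godel] makes them the one program [c]. *)
have [c cE _] := ge 0.
have [p [Gp]] : G `&` avoids c !=set0.
  have [p [Gp]] := GDn (pairn 2 e).
  by rewrite /D !piE => /= pc; exists p; split=> //; apply: pc.
have cg x : eval (jump (join (RvecG G) (fG_set G))) c x (g x).
  by have [c' c'E] := ge x; rewrite -(godel_inj (etrans c'E (esym cE))).
case=> [[x xP]|[x [y [s [cy xy]]]]].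
  (* Convergence at [x] uses finitely much of the jump, which some condition of [G] below [p]
     already settles; the run would converge there. *)
  have [s sP] := bounded_eval_complete (cg x).
  have [q [Gq qp] qP] := jump_answer_complete GF Glong Gdecides s Gp.
  by have := bounded_eval_mono qP (leqnn s) sP; rewrite xP.
(* By soundness the value [y] forced by [p] is the actual value [g x], and it is also the diagonal
   value at [x]. *)
apply: (gDNC x).
suff -> : g x = y :> nat by [].
apply: eval_fun (cg x) _.
apply: bounded_eval_sound cy => z; first by case: (jump_answer_sound GF Glong z Gp).
by move=> b; case: (jump_answer_sound GF Glong z Gp) => _; apply.
Qed.
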